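(* There exists $h_0$ such that for every $h>h_0$ and every strongly asymmetric graph $H \in \mathcal{P}_h$ on $h$ vertices, $$i_H \le \frac{h!}{h^h-h}\cdot\left(1+\frac{4}{h^{h^{1/3}}}\right).$$
   Context: All graphs are finite and simple; $[h]=\{1,\dots,h\}$; all logarithms are base $2$; $H[S]$ is the subgraph of $H$ induced by $S$. $i_H(G)$ is the number of induced copies of $H$ in $G$, $i_H(n)$ is the maximum of $i_H(G)$ over all graphs $G$ with $n$ vertices, and the inducibility of $H$ is $i_H=\lim_{n\to\infty} i_H(n)/\binom{n}{h}$ (the limit exists). **Blowups.** For a graph $F$ with vertices $v_1,\dots,v_s$ and positive integers $a_1,\dots,a_s$, the blowup $F(a_1,\dots,a_s)$ has as vertex set the disjoint union of independent sets (parts) $A_1,\dots,A_s$ with $|A_i|=a_i$; for $i\ne j$, all pairs between $A_i$ and $A_j$ are edges if $v_iv_j\in E(F)$, and none are edges otherwise. A pair of distinct vertices of a blowup is a part pair if both lie in the same part, and a blowup pair otherwise. Changing a pair means turning an edge into a non-edge or vice versa. **Closeness.** Let $B$ be a blowup of some graph and $B'$ a graph of the same order. $B$ is blowup $m$-close to $B'$ if one can change at most $m$ blowup pairs of $B$ and arbitrarily change part pairs of $B$ so that the resulting graph is isomorphic to $B'$; otherwise it is blowup $m$-far from $B'$. For graphs $H_1,H_2$ of the same order and a bijection $\pi:V(H_1)\to V(H_2)$, $\pi$ is $m$-close to an isomorphism between $H_1$ and $H_2$ if one can change at most $m$ pairs of $H_1$ so that $\pi$ is an isomorphism from the obtained graph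 to $H_2$; otherwise $\pi$ is $m$-far from an isomorphism. A stationary point of $\pi$ is a vertex $v$ with $\pi(v)=v$. **Agreement and distinguishing sets.** For $S\subset V(H)$, the agreement set $A(S)$ is the set of vertices $w\in V(H)\setminus S$ that are either adjacent to all vertices of $S$ or non-adjacent to all vertices of $S$. A set $Q\subset V(H)$ is distinguishing if $Q$ is not contained in the agreement set of any two vertices outside $Q$. **Strongly asymmetric graphs.** A graph $H$ on vertex set $[h]$ is strongly asymmetric ($H\in\mathcal{P}_h$) if all of the following hold: 1. Every vertex degree is larger than $0.4h$ and smaller than $0.6h$. 2. The agreement set of every pair of vertices has order at most $0.55h$, and the agreement set of every triple of vertices has order at most $0.3h$. 3. $H$ has a distinguishing set of order at most $3\log h$. 4. For every $S\subset[h]$ with $|S|\le 0.7h$, every blowup $B$ of $H[S]$ with at least $0.8h$ and at most $h$ vertices in which each part has at most $h/100$ vertices, and every $K\subseteq[h]$ (with $|K|=|V(B)|$, as needed for the comparison), $B$ is blowup $10^{-5}h^2$-far from $H[K]$. 5. For all $J,K\subset[h]$ with $|J|=|K|=\lceil 0.7h\rceil$ and every bijection $\pi:J\to K$ with at least $0.1h$ non-stationary points, $\pi$ is $10^{-5}h^2$-far from an isomorphism between $H[J]$ and $H[K]$. *)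

(* Defs.v *)
From HB Require Import structures.
From mathcomp Require Import all_boot all_order all_algebra.
From mathcomp Require Import boolp reals topology normedtype sequences exp.

Set Implicit Arguments.
Unset Strict Implicit.
Unset Printing Implicit Defensive.

Import Order.TTheory GRing.Theory Num.Theory.
Import numFieldNormedType.Exports.

Local Open Scope ring_scope.

Definition simple_rel (T : finType) (f : {ffun T * T -> bool}) : bool :=
  [forall x, ~~ f (x, x)] && [forall x, forall y, f (x, y) == f (y, x)].

(* Adjacency is stored as a finite function so that the simple graphs on T form
   a finType, over which a maximum can be taken. *)
Record sgraph (T : finType) := SGraph {
  adj_fun : {ffun T * T -> bool};
  adj_simple : simple_rel adj_fun }.

HB.instance Definition _ (T : finType) := [isSub for @adj_fun T].
HB.instance Definition _ (T : finType) := [Countable of sgraph T by <:].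
HB.instance Definition _ (T : finType) := [Finite of sgraph T by <:].

Definition adj (T : finType) (G : sgraph T) : rel T :=
  fun x y => adj_fun G (x, y).

Lemma adj_irr (T : finType) (G : sgraph T) (x : T) : adj G x x = false.
Proof.
by have /andP[/forallP/(_ x) h _] := adj_simple G; apply/negbTE.
Qed.

Lemma adj_sym (T : finType) (G : sgraph T) (x y : T) : adj G x y = adj G y x.
Proof.
by have /andP[_ /forallP/(_ x)/forallP/(_ y)/eqP] := adj_simple G.
Qed.

Lemma simple_relP (T : finType) (r : rel T) :
  irreflexive r -> symmetric r -> simple_rel [ffun p => r p.1 p.2].
Proof.
move=> ri rs; apply/andP; split; apply/forallP => x; first by rewrite ffunE ri.
by apply/forallP => y; rewrite !ffunE /= rs.
Qed.

Definition mk_sgraph (T : finType) (r : rel T)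
    (ri : irreflexive r) (rs : symmetric r) : sgraph T :=
  SGraph (simple_relP ri rs).

Lemma adj_mk (T : finType) (r : rel T) (ri : irreflexive r) (rs : symmetric r)
  (x y : T) : adj (mk_sgraph ri rs) x y = r x y.
Proof. by rewrite /adj ffunE. Qed.

Definition is_iso (T U : finType) (G : sgraph T) (H : sgraph U)
    (f : T -> U) : Prop :=
  bijective f /\ forall x y, adj H (f x) (f y) = adj G x y.

Definition isomorphic (T U : finType) (G : sgraph T) (H : sgraph U) : Prop :=
  exists f : T -> U, is_iso G H f.

Definition induced_rel (T : finType) (G : sgraph T) (S : {set T}) :
    rel {x : T | x \in S} :=
  fun x y => adj G (val x) (val y).

Lemma induced_irr (T : finType) (G : sgraph T) (S : {set T}) :
  irreflexive (@induced_rel T G S).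
Proof. by move=> x; apply: adj_irr. Qed.

Lemma induced_sym (T : finType) (G : sgraph T) (S : {set T}) :
  symmetric (@induced_rel T G S).
Proof. by move=> x y; apply: adj_sym. Qed.

Definition induced (T : finType) (G : sgraph T) (S : {set T}) :
    sgraph {x : T | x \in S} :=
  mk_sgraph (@induced_irr T G S) (@induced_sym T G S).

Definition num_induced (U T : finType) (H : sgraph U) (G : sgraph T) : nat :=
  #|[set S : {set T} | `[< isomorphic (induced G S) H >]]|.

Definition max_induced (U : finType) (H : sgraph U) (n : nat) : nat :=
  \max_(G : sgraph 'I_n) num_induced H G.

(* The terms with n < #|U| are 0 / 0 = 0 and do not affect the limit. *)
Definition inducibility (R : realType) (U : finType) (H : sgraph U) : R :=
  limn (fun n : nat => (max_induced H n)%:R / ('C(n, #|U|))%:R : R).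

Definition blowup_vertex (I : finType) (a : I -> nat) : finType :=
  {i : I & 'I_(a i)}.

Definition blowup_rel (I : finType) (F : sgraph I) (a : I -> nat) :
    rel (blowup_vertex a) :=
  fun u v => adj F (tag u) (tag v).

Lemma blowup_irr (I : finType) (F : sgraph I) (a : I -> nat) :
  irreflexive (@blowup_rel I F a).
Proof. by move=> x; apply: adj_irr. Qed.

Lemma blowup_sym (I : finType) (F : sgraph I) (a : I -> nat) :
  symmetric (@blowup_rel I F a).
Proof. by move=> x y; apply: adj_sym. Qed.

(* Parts are independent because F is irreflexive. *)
Definition blowup (I : finType) (F : sgraph I) (a : I -> nat) :
    sgraph (blowup_vertex a) :=
  mk_sgraph (@blowup_irr I F a) (@blowup_sym I F a).

(* The unordered pairs related by P on which G1 and G2 differ *)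
Definition changed_pairs (T : finType) (P : rel T) (G1 G2 : sgraph T) :
    {set {set T}} :=
  [set [set p.1; p.2] | p : T * T
     & P p.1 p.2 && (adj G1 p.1 p.2 != adj G2 p.1 p.2)].

Definition any_pair (T : finType) : rel T := fun x y => x != y.

Definition blowup_pair (I : finType) (a : I -> nat) : rel (blowup_vertex a) :=
  fun u v => tag u != tag v.

Definition blowup_close (R : realType) (I U : finType) (F : sgraph I)
    (a : I -> nat) (G : sgraph U) (m : R) : Prop :=
  exists B : sgraph (blowup_vertex a),
    #|changed_pairs (@blowup_pair I a) (blowup F a) B|%:R <= m
    /\ isomorphic B G.

Definition blowup_far (R : realType) (I U : finType) (F : sgraph I)
    (a : I -> nat) (G : sgraph U) (m : R) : Prop :=
  ~ blowup_close F a G m.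

Definition close_to_iso (R : realType) (T U : finType) (G : sgraph T)
    (H : sgraph U) (f : T -> U) (m : R) : Prop :=
  exists G' : sgraph T,
    #|changed_pairs (@any_pair T) G G'|%:R <= m /\ is_iso G' H f.

Definition far_from_iso (R : realType) (T U : finType) (G : sgraph T)
    (H : sgraph U) (f : T -> U) (m : R) : Prop :=
  ~ close_to_iso G H f m.

Definition degree (T : finType) (G : sgraph T) (v : T) : nat :=
  #|[set w | adj G v w]|.

Definition agreement (T : finType) (G : sgraph T) (S : {set T}) : {set T} :=
  [set w in ~: S | [forall s in S, adj G w s] || [forall s in S, ~~ adj G w s]].

Definition distinguishing (T : finType) (G : sgraph T) (Q : {set T}) : Prop :=
  forall x y : T, x \notin Q -> y \notin Q -> x != y ->
    ~~ (Q \subset agreement G [set x; y]).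

Definition log2 (R : realType) (x : R) : R := ln x / ln 2.

Definition sa_degrees (R : realType) (h : nat) (H : sgraph 'I_h) : Prop :=
  forall v : 'I_h, 4 / 10 * h%:R < ((degree H v)%:R : R) < 6 / 10 * h%:R.

Definition sa_agreement (R : realType) (h : nat) (H : sgraph 'I_h) : Prop :=
  (forall S : {set 'I_h}, #|S| = 2%N ->
     (#|agreement H S|%:R : R) <= 55 / 100 * h%:R)
  /\ (forall S : {set 'I_h}, #|S| = 3%N ->
     (#|agreement H S|%:R : R) <= 3 / 10 * h%:R).

Definition sa_distinguishing (R : realType) (h : nat) (H : sgraph 'I_h) : Prop :=
  exists Q : {set 'I_h},
    distinguishing H Q /\ (#|Q|%:R : R) <= 3 * log2 h%:R.

Definition sa_blowups (R : realType) (h : nat) (H : sgraph 'I_h) : Prop :=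
  forall (S : {set 'I_h}) (a : {x : 'I_h | x \in S} -> nat) (K : {set 'I_h}),
    (#|S|%:R : R) <= 7 / 10 * h%:R ->
    (forall i, (0 < a i)%N) ->
    (forall i, ((a i)%:R : R) <= h%:R / 100) ->
    (8 / 10 * h%:R : R) <= #|blowup_vertex a|%:R ->
    (#|blowup_vertex a| <= h)%N ->
    #|K| = #|blowup_vertex a| ->
    blowup_far (induced H S) a (induced H K) (h%:R ^+ 2 / 10 ^+ 5 : R).

Definition sa_bijections (R : realType) (h : nat) (H : sgraph 'I_h) : Prop :=
  forall (J K : {set 'I_h})
         (f : {x : 'I_h | x \in J} -> {x : 'I_h | x \in K}),
    Posz #|J| = Num.ceil (7 / 10 * h%:R : R) ->
    Posz #|K| = Num.ceil (7 / 10 * h%:R : R) ->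
    bijective f ->
    (h%:R / 10 : R) <= #|[set v | val (f v) != val v]|%:R ->
    far_from_iso (induced H J) (induced H K) f (h%:R ^+ 2 / 10 ^+ 5 : R).

Definition strongly_asymmetric (R : realType) (h : nat) (H : sgraph 'I_h) : Prop :=
  [/\ sa_degrees R H, sa_agreement R H, sa_distinguishing R H,
      sa_blowups R H & sa_bijections R H].

(* Main.v *)
Require Import Defs.
From HB Require Import structures.
From mathcomp Require Import all_boot all_order all_algebra.
From mathcomp Require Import boolp reals topology normedtype sequences exp.
From mathcomp Require Import perm zify ring lra.

(* Averaging gives i_H <= i_H(n) / C(n, h) for every n, so it is enough to bound
   the number of embeddings of H in an n-vertex graph G for one n, of the form
   n = h^(r+2) with r about sqrt h; all that matters is that h^2 / n is at most
   h^(-h^(1/3)) while n^(O(log h)) = 2^(o(h)).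

   Say that x in V(G) has role w if at least n^(-3) (n/h)^h embeddings map w to
   x. Embeddings using some (w, x) without that role are negligible, and if
   every x has at most one role, AM-GM bounds the other embeddings by (n/h)^h.

   Suppose that x has two roles w <> w'. Fixing the images of a distinguishing
   set Q costs only a factor n^|Q|, and afterwards the possible images of the
   vertices outside Q are pairwise disjoint. Since the embeddings sending w' to
   x are so numerous, AM-GM forces these classes to cover nearly all of G and to
   make G nearly a blowup of H. Among the numerous embeddings f sending w to x
   one meets few of the exceptional vertices and pairs, so mapping i to the
   class containing f i nearly preserves adjacency and nonadjacency. Conditions
   4 and 5 then make at least 0.6h vertices i stationary, and those lie in the
   agreement set of {w, w'}, which is too small. *)

Set Implicit Arguments.
Unset Strict Implicit.
Unset Printing Implicit Defensive.

Import Order.TTheory GRing.Theory Num.Theory.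
Import numFieldNormedType.Exports.

Local Open Scope ring_scope.

(** * Copies, embeddings and averaging *)

Definition embeddings (U T : finType) (H : sgraph U) (G : sgraph T) :
    {set {ffun U -> T}} :=
  [set f : {ffun U -> T} | injectiveb f
     && [forall u, forall v, adj G (f u) (f v) == adj H u v]].

Lemma embeddingsP (U T : finType) (H : sgraph U) (G : sgraph T)
    (f : {ffun U -> T}) :
  reflect (injective f /\ forall u v, adj G (f u) (f v) = adj H u v)
    (f \in embeddings H G).
Proof.
rewrite inE; apply: (iffP andP) => -[/injectiveP fi fH]; split=> //.
  by move=> u v; move/forallP: fH => /(_ u)/forallP/(_ v)/eqP.
by apply/forallP => u; apply/forallP => v; apply/eqP.
Qed.

Lemma copyP (U T : finType) (H : sgraph U) (G : sgraph T) (S : {set T}) :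
  isomorphic (induced G S) H <->
  exists2 f, f \in embeddings H G & f @: [set: U] = S.
Proof.
split=> [[g [[g' gK g'K] gG]]|[f /embeddingsP [fi fG] <-]].
  exists [ffun u => val (g' u)].
    apply/embeddingsP; split=> [u v|u v]; rewrite !ffunE.
      by move=> /val_inj /(can_inj g'K).
    by rewrite -{2}(g'K u) -{2}(g'K v) gG adj_mk.
  apply/setP => x; apply/imsetP/idP => [[u _ ->]|xS]; first by rewrite ffunE; exact: (valP (g' u)).
  by exists (g (Sub x xS)); rewrite ?ffunE ?gK.
have mem_f u : f u \in f @: [set: U] by exact: imset_f.
pose e u : {x : T | x \in f @: [set: U]} := Sub (f u) (mem_f u).
have ex (x : {x : T | x \in f @: [set: U]}) : exists u, f u = val x.
  by have /imsetP[u _ ->] := valP x; exists u.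
pose g x := projT1 (cid (ex x)).
have gP x : f (g x) = val x by rewrite /g; case: cid.
exists g; split.
  exists e; first by move=> x; apply: val_inj; rewrite /= gP.
  by move=> u; apply: fi; rewrite gP.
by move=> x y; rewrite adj_mk /induced_rel -!gP fG.
Qed.

Lemma num_induced_le_embeddings (U T : finType) (H : sgraph U) (G : sgraph T) :
  (num_induced H G <= #|embeddings H G|)%N.
Proof.
apply: leq_trans (leq_imset_card (fun f : {ffun U -> T} => f @: [set: U]) _).
apply: subset_leq_card; apply/subsetP => S; rewrite inE => /asboolP.
by move=> /copyP [f fE <-]; exact: imset_f.
Qed.

Lemma num_induced_card (U T : finType) (H : sgraph U) (G : sgraph T)
    (S : {set T}) :
  S \in [set S : {set T} | `[< isomorphic (induced G S) H >]] -> #|S| = #|U|.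
Proof.
rewrite inE => /asboolP /copyP [f /embeddingsP[fi _] <-].
by rewrite card_imset // cardsT.
Qed.

Section pullback.
Variables (T U : finType) (G : sgraph U) (e : T -> U).

Definition pullback_rel : rel T := fun x y => adj G (e x) (e y).
Lemma pullback_irr : irreflexive pullback_rel.
Proof. by move=> x; exact: adj_irr. Qed.
Lemma pullback_sym : symmetric pullback_rel.
Proof. by move=> x y; exact: adj_sym. Qed.
Definition pullback : sgraph T := mk_sgraph pullback_irr pullback_sym.

Lemma adj_pullback x y : adj pullback x y = adj G (e x) (e y).
Proof. exact: adj_mk. Qed.
End pullback.

(** Double counting of the pairs of a copy and a vertex [v] outside it: each copy avoids
    [n.+1 - #|U|] vertices, and a copy avoiding [v] survives in the pullback along [lift v], which
    deletes [v]. *)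
Lemma max_induced_averaging (U : finType) (H : sgraph U) (n : nat) :
  (max_induced H n.+1 * (n.+1 - #|U|) <= n.+1 * max_induced H n)%N.
Proof.
pose P (G : sgraph 'I_n.+1) := [set S : {set 'I_n.+1} | `[< isomorphic (induced G S) H >]].
suff key G : (#|P G| * (n.+1 - #|U|) <= n.+1 * max_induced H n)%N.
  rewrite /max_induced mulnC big_distrr /=; apply/bigmax_leqP => G _.
  by rewrite mulnC; exact: key.
have -> : (#|P G| * (n.+1 - #|U|) = \sum_(S in P G) \sum_(v : 'I_n.+1 | v \notin S) 1)%N.
  rewrite -sum_nat_const; apply: eq_bigr => S SP.
  rewrite sum1_card -(num_induced_card SP).
  have := cardsC S; rewrite card_ord => /(congr1 (subn^~ #|S|)); rewrite addKn => <-.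
  by apply: eq_card => v; rewrite !inE.
rewrite (exchange_big_dep xpredT) //=.
have -> (m : nat) : (n.+1 * m = \sum_(v : 'I_n.+1) m)%N by rewrite sum_nat_const card_ord.
apply: leq_sum => v _.
rewrite sum1dep_card.
apply: leq_trans (leq_bigmax (pullback G (lift v))).
rewrite /num_induced -[X in (X <= _)%N](@card_in_imset _ _
    (fun S : {set 'I_n.+1} => lift v @^-1: S)); last first.
  move=> S S'; rewrite !inE => /andP[_ vS] /andP[_ vS'] /setP eqS.
  apply/setP => x; case: (unliftP v x) => [y ->|->].
    by have := eqS y; rewrite !inE.
  by rewrite (negbTE vS) (negbTE vS').
apply: subset_leq_card; apply/subsetP => _ /imsetP[S + ->].
rewrite !inE => /andP[/asboolP /copyP[f /embeddingsP[fi fG] fS] vS].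
have vf u : v != f u.
  by apply: contra vS => /eqP ->; rewrite -fS imset_f.
have ex u : exists y, f u = lift v y.
  by case: (unliftP v (f u)) => [y ->|/eqP]; [exists y|rewrite eq_sym (negbTE (vf u))].
pose g := [ffun u => projT1 (cid (ex u))].
have gP u : f u = lift v (g u) by rewrite /g ffunE; case: cid.
apply/asboolP/copyP; exists g.
  apply/embeddingsP; split=> [u u' eqg|u u']; first by apply: fi; rewrite !gP eqg.
  by rewrite adj_pullback -!gP fG.
apply/setP => y; rewrite inE -fS.
apply/imsetP/imsetP => -[u _ eqy]; exists u => //; first by rewrite gP eqy.
by apply: (@lift_inj _ v); rewrite -gP.
Qed.

Lemma inducibility_le (R : realType) (U : finType) (H : sgraph U) (n : nat) :
  (#|U| <= n)%N ->
  inducibility R H <= (max_induced H n)%:R / ('C(n, #|U|))%:R.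
Proof.
move=> Un; rewrite /inducibility.
set u : nat -> R := fun n => _.
have step m : (#|U| <= m)%N -> u m.+1 <= u m.
  move=> Um; rewrite /u ler_pdivrMr; last by rewrite ltr0n bin_gt0 ltnW.
  rewrite mulrAC ler_pdivlMr ?ltr0n ?bin_gt0 // -!natrM ler_nat.
  rewrite -(@leq_pmul2r (m.+1 - #|U|)); last by rewrite subn_gt0.
  have /= E := mul_bin_left m.+1 #|U|.
  have := max_induced_averaging H m.
  rewrite -(@leq_pmul2r 'C(m, #|U|)); last by rewrite bin_gt0.
  have := mul_bin_down m.+1 #|U| => /=.
  nia.
have mono m k : (#|U| <= m)%N -> (m <= k)%N -> u k <= u m.
  move=> Um; elim: k => [|k IH]; first by rewrite leqn0 => /eqP <-.
  rewrite leq_eqVlt => /predU1P[<- //|mk].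
  by apply: le_trans (IH mk); apply: step; exact: leq_trans Um mk.
(* Monotonicity starts at index [#|U|], as the earlier terms are 0 / 0 = 0; hence the shift. *)
have noninc : nonincreasing_seq [sequence u (k + #|U|)%N]_k.
  by apply/nonincreasing_seqP => k /=; rewrite addSn; apply: step; exact: leq_addl.
have cv : cvgn [sequence u (k + #|U|)%N]_k.
  apply: nonincreasing_is_cvgn => //.
  exists 0 => _ [k _ <-] /=; rewrite /u.
  by rewrite divr_ge0.
have cvu : cvgn u by case/cvg_ex: cv => l ul; apply/cvg_ex; exists l; rewrite -(cvg_shiftn #|U|).
apply: limr_le => //.
near=> k; apply: mono => //.
near: k; exact: nbhs_infty_ge.
Unshelve. all: by end_near. Qed.

(** * Counting families of functions *)

Lemma expn_le_compat (m n e : nat) : (m <= n)%N -> (m ^ e <= n ^ e)%N.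
Proof. by case: e => // e; rewrite leq_exp2r. Qed.

Lemma prodn_AGM (I : finType) (E : I -> nat) :
  ((\prod_i E i) * #|I| ^ #|I| <= (\sum_i E i) ^ #|I|)%N.
Proof.
have E0 i : i \in I -> 0 <= (E i)%:R *+ #|I| :> rat by rewrite -mulrnA.
have [] := leif_AGM_scaled E0.
set l := \prod_(i in I) _; set r := (X in l <= X ^+ _) => + _.
have -> : l = ((\prod_i E i) * #|I| ^ #|I|)%:R.
  rewrite /l natrM natr_prod natrX -prodr_const -big_split /=.
  by apply: eq_bigr => i _; rewrite mulr_natr.
have -> : r = (\sum_i E i)%:R by rewrite natr_sum.
by rewrite -natrX ler_nat.
Qed.

(* The coordinates outside B are unconstrained; in the AM-GM inequality they are
   counted as parts of size 1, so that the exponent is #|I| on both sides. *)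
Lemma card_family_le (I T : finType) (F : {set {ffun I -> T}}) (B : {set I})
    (Y : I -> {set T}) :
  (forall f b, f \in F -> b \in B -> f b \in Y b) ->
  {in B &, forall b c, b != c -> [disjoint Y b & Y c]} ->
  (#|F| * #|I| ^ #|I| <= #|T| ^ (#|I| - #|B|)
     * (#|\bigcup_(b in B) Y b| + (#|I| - #|B|)) ^ #|I|)%N.
Proof.
move=> FY dY.
have cB : (#|I| - #|B| = #|~: B|)%N by rewrite -(cardsC B) addKn.
have leF : (#|F| <= \prod_(i in B) #|Y i| * #|T| ^ #|~: B|)%N.
  pose D i := if i \in B then mem (Y i) else mem [set: T].
  have : F \subset family D.
    apply/subsetP => f fF; apply/familyP => i; rewrite /D.
    by case: ifP => iB; [exact: FY|rewrite inE].
  move/subset_leq_card/leq_trans; apply; rewrite card_family foldrE big_map big_enum /=.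
  rewrite (bigID (mem B)) /= leq_mul //.
    by rewrite eq_leq //; apply: eq_bigr => i iB; rewrite /D iB.
  rewrite eq_leq // (eq_bigr (fun=> #|T|)) => [|i iB]; last by rewrite /D (negbTE iB) cardsT.
  by rewrite -prod_nat_const; apply: eq_bigl => i; rewrite inE.
have sU : (\sum_(i in B) #|Y i| = #|\bigcup_(b in B) Y b|)%N.
  rewrite big_mkcond (big_mkcond (mem B) Y) -sum1_card /=.
  rewrite (@partition_disjoint_bigcup _ _ _ _ _ (fun i => if i \in B then Y i else set0)) =>
    [|i j ij].
    by apply: eq_bigr => i _; case: ifP => _; rewrite sum1_card // cards0.
  by case: ifP => iB; case: ifP => jB;
    rewrite ?disjoints_subset ?sub0set ?setC0 ?subsetT // -disjoints_subset dY.
apply: leq_trans (leq_mul leF (leqnn _)) _.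
rewrite cB mulnAC mulnC leq_mul2l; apply/orP; right.
have := prodn_AGM (fun i => if i \in B then #|Y i| else 1%N).
rewrite -big_mkcond /=.
rewrite [X in (_ <= X ^ _)%N -> _](_ : _ = #|\bigcup_(b in B) Y b| + #|~: B|)%N //.
rewrite (bigID (mem B)) /= -sU -sum1_card; congr (_ + _)%N.
  by apply: eq_bigr => i ->.
by apply: eq_big => i; [rewrite inE|move/negbTE ->].
Qed.

Lemma pigeonhole_fiber (A B : finType) (g : A -> B) (F : {set A}) : (0 < #|F|)%N ->
  exists b, (#|F| <= #|B| * #|[set a in F | g a == b]|)%N.
Proof.
move=> /card_gt0P [a0 _].
pose b := [arg max_(b > g a0) #|[set a in F | g a == b]|]; exists b.
rewrite -sum1_card (partition_big g xpredT) //= -sum_nat_const.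
apply: leq_sum => c _; rewrite sum1dep_card /b; case: arg_maxnP => // i _; apply.
by [].
Qed.

(** * Exponential moments of the number of bad entries *)

Section exponential_moment.
Variables (V : finType) (Bad : seq V -> pred V).

(* Bad depends on the entries after the head, so a tuple is exposed from its end. *)
Fixpoint num_bad (t : seq V) : nat :=
  if t is x :: t' then Bad t' x + num_bad t' else 0.

Lemma sum_tuple_cons (n : nat) (F : n.+1.-tuple V -> nat) :
  (\sum_(t : n.+1.-tuple V) F t = \sum_(t : n.-tuple V) \sum_(x : V) F [tuple of x :: t])%N.
Proof.
rewrite pair_big /= (reindex (fun p : n.-tuple V * V => [tuple of p.2 :: p.1])) //=.
exists (fun t : n.+1.-tuple V => ([tuple of behead t], thead t)) => [[t x] _|t _] /=.
  by congr (_, _); apply: val_inj.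
by rewrite -tuple_eta.
Qed.

(** Entries are exposed one by one: whatever the tail, at most [D] heads are bad, so summing over
    the head costs a factor of at most [#|V| + l * D]. *)
Lemma num_bad_moment (h D l n : nat) :
  (forall t, (size t < h)%N -> (#|[set x | Bad t x]| <= D)%N) -> (n <= h)%N ->
  (\sum_(t : n.-tuple V) l ^ num_bad t <= (#|V| + l * D) ^ n)%N.
Proof.
move=> BadD; elim: n => [_|n IH nh].
  rewrite expn0 (eq_bigr (fun=> 1%N)) => [|t _]; last by rewrite tuple0.
  by rewrite sum_nat_const card_tuple expn0.
rewrite sum_tuple_cons expnSr.
apply: leq_trans (leq_mul (IH (ltnW nh)) (leqnn _)).
rewrite big_distrl /=; apply: leq_sum => t _.
rewrite (eq_bigr (fun x => l ^ num_bad t * l ^ Bad t x)%N) => [|x _]; last by rewrite addnC expnD.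
rewrite -big_distrr leq_mul2l; apply/orP; right => /=.
apply: (@leq_trans (\sum_(x : V) (1 + l * Bad t x))%N).
  by apply: leq_sum => x _; case: (Bad t x); rewrite ?expn1 ?muln1 // leq_addl.
rewrite big_split /= sum1_card leq_add2l -big_distrr leq_mul2l; apply/orP; right => /=.
rewrite (_ : \sum_x _ = #|[set x | Bad t x]|)%N; first by rewrite BadD // size_tuple.
by rewrite -sum1dep_card [in RHS]big_mkcond; apply: eq_bigr => x _; case: (Bad t x).
Qed.

(** Markov's inequality for [l ^ num_bad]. *)
Lemma card_num_bad (h D l k : nat) :
  (forall t, (size t < h)%N -> (#|[set x | Bad t x]| <= D)%N) -> (0 < l)%N ->
  (l * D <= #|V|)%N ->
  (#|[set t : h.-tuple V | k <= num_bad t]%N| * l ^ k <= (2 * #|V|) ^ h)%N.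
Proof.
move=> BadD l0 lD.
have := num_bad_moment l BadD (leqnn h).
have : ((#|V| + l * D) ^ h <= (2 * #|V|) ^ h)%N by apply: expn_le_compat; lia.
move=> /[swap] /leq_trans /[apply]; apply: leq_trans.
rewrite -sum1dep_card big_distrl /=.
rewrite [X in (_ <= X)%N](bigID (fun t : h.-tuple V => (k <= num_bad t)%N)) /=.
apply: leq_trans (leq_addr _ _); apply: leq_sum => t kt.
by rewrite mul1n leq_pexp2l.
Qed.
End exponential_moment.

(** * Large families of embeddings force a near-blowup *)

(* Up to the factor #|V| ^ c, F has at least (#|V| / h) ^ h elements, which is
   the number of transversals of a balanced partition of V into h parts. *)
Definition rich (h : nat) (V : finType) (c : nat) (F : {set {ffun 'I_h -> V}}) :=
  (#|V| ^ h <= #|F| * #|V| ^ c * h ^ h)%N.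

Lemma rich_trans (h : nat) (V : finType) (c d : nat) (F F' : {set {ffun 'I_h -> V}}) :
  rich c F -> (#|F| <= #|V| ^ d * #|F'|)%N -> rich (c + d) F'.
Proof.
rewrite /rich => /leq_trans rF FF'; apply: rF.
rewrite leq_mul2r; apply/orP; right.
by rewrite expnD mulnA [X in (_ <= X)%N]mulnC mulnA mulnC [X in (_ <= X)%N]mulnC leq_mul.
Qed.

(** If more than [#|V| / N] vertices were uncovered, AM-GM would bound [F] with an extra factor (1 -
    1/(2N))^h, too small to be made up by [#|V| ^ (c + q.+1)]. *)
Lemma rich_cover (h : nat) (V : finType) (c q N : nat) (F : {set {ffun 'I_h -> V}})
    (B : {set 'I_h}) (Y : 'I_h -> {set V}) :
  (forall f b, f \in F -> b \in B -> f b \in Y b) ->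
  {in B &, forall b d, b != d -> [disjoint Y b & Y d]} ->
  (h <= #|B| + q.+1)%N -> (0 < N)%N -> (2 * N * q.+1 <= #|V|)%N ->
  (#|V| ^ (c + q.+1) * (2 * N - 1) ^ h < (2 * N) ^ h)%N ->
  rich c F -> (#|~: \bigcup_(b in B) Y b| * N <= #|V|)%N.
Proof.
move=> FY dY hB N0 NV powV rF; rewrite leqNgt; apply/negP => big.
have V0 : (0 < #|V|)%N by apply: leq_trans NV; rewrite !muln_gt0 N0.
have := card_family_le FY dY; rewrite card_ord => cF.
have hBq : (h - #|B| <= q.+1)%N by rewrite leq_subLR.
set s := #|\bigcup_(b in B) Y b| in cF.
have sV : (s + #|~: \bigcup_(b in B) Y b| = #|V|)%N by exact: cardsC.
(* Half of the missing [#|V| / N] pays for the at most [q.+1] unconstrained coordinates, counted as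
   parts of size 1. *)
have sN : (2 * N * (s + (h - #|B|)) <= (2 * N - 1) * #|V|)%N.
  move: big hBq sV NV N0; clear; move: (h - _)%N => r; nia.
have : (#|V| ^ h <= #|V| ^ (c + q.+1) * (s + (h - #|B|)) ^ h)%N.
  apply: leq_trans rF _; rewrite mulnAC.
  apply: leq_trans (leq_mul cF (leqnn _)) _.
  by rewrite mulnAC leq_mul // addnC expnD leq_mul // leq_pexp2l.
rewrite -(@leq_pmul2l ((2 * N) ^ h)) ?expn_gt0 ?muln_gt0 ?N0 //.
rewrite mulnCA -(expnMn _ (s + _)) => le1.
have : ((2 * N * (s + (h - #|B|))) ^ h <= ((2 * N - 1) * #|V|) ^ h)%N.
  exact: expn_le_compat.
rewrite [X in (_ <= X)%N]expnMn => le2.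
have := leq_trans le1 (leq_mul (leqnn _) le2).
by rewrite mulnA leq_pmul2r ?expn_gt0 ?V0 // leqNgt powV.
Qed.

Section structure.
Variables (h : nat) (H : sgraph 'I_h) (V : finType) (G : sgraph V).
Variables (Q : {set 'I_h}) (N : nat).
Hypothesis dQ : distinguishing H Q.
Hypothesis h0 : (0 < h)%N.
Hypothesis hV : (2 * h <= #|V|)%N.

Let V2 : (2 <= #|V|)%N. Proof. lia. Qed.
Let V0 : (0 < #|V|)%N. Proof. lia. Qed.

Definition agree_on (F : {set {ffun 'I_h -> V}}) :=
  forall f g i, f \in F -> g \in F -> i \in Q -> f i = g i.

Lemma rich_agree (c : nat) (F : {set {ffun 'I_h -> V}}) : rich c F ->
  exists F' : {set {ffun 'I_h -> V}},
    [/\ F' \subset F, rich (c + #|Q|) F' & agree_on F'].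
Proof.
move=> rF; pose g (f : {ffun 'I_h -> V}) := [ffun i : {i | i \in Q} => f (val i)].
have F0 : (0 < #|F|)%N.
  rewrite lt0n; apply/eqP => F0; move: rF.
  by rewrite /rich F0 !mul0n leqn0 expn_eq0; move: V0; case: #|V|.
have [b Fb] := pigeonhole_fiber g F0.
exists [set f in F | g f == b]; split.
- by apply/subsetP => f; rewrite inE => /andP[].
- by apply: rich_trans rF _; rewrite card_ffun card_sig in Fb.
- move=> f f' i; rewrite !inE => /andP[_ /eqP <-] /andP[_ /eqP gg] iQ.
  by have /ffunP/(_ (Sub i iQ)) := gg; rewrite !ffunE.
Qed.

(** The common images of [Q] reveal the adjacencies of [u] and of [v] to [Q]. If [f u = g v] these
    coincide, and for [u != v] this would put [Q] inside an agreement set. *)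
Lemma agree_disjoint (F : {set {ffun 'I_h -> V}}) (f g : {ffun 'I_h -> V}) (u v : 'I_h) :
  F \subset embeddings H G -> agree_on F -> f \in F -> g \in F ->
  u \notin Q -> v \notin Q -> f u = g v -> u = v.
Proof.
move=> /subsetP FE aF fF gF uQ vQ fg; apply/eqP/negPn/negP => uv.
have /subsetPn[c cQ] := dQ uQ vQ uv; case/negP.
have /embeddingsP[_ fG] := FE _ fF; have /embeddingsP[_ gG] := FE _ gF.
have E : adj H c u = adj H c v by rewrite -fG -gG fg (aF f g c).
rewrite !inE negb_or; apply/andP; split.
  by apply/andP; split; [apply: contraNneq uQ => <-|apply: contraNneq vQ => <-].
case E1: (adj H c u).
  apply/orP; left; apply/forall_inP => s; rewrite !inE => /orP[]/eqP -> //.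
  by rewrite -E.
apply/orP; right; apply/forall_inP => s; rewrite !inE => /orP[]/eqP ->.
  by rewrite E1.
by rewrite -E E1.
Qed.

(** Fixing a popular value at [a] preserves richness up to 2 more in the exponent. *)
Definition popular (F : {set {ffun 'I_h -> V}}) (a : 'I_h) (y : V) :=
  (#|F| <= #|V| ^ 2 * #|[set f in F | f a == y]|)%N.

(** Each of the at most [h * #|V|] unpopular pairs is used by less than a fraction [#|V| ^ -2] of
    [F]; together they spoil at most half of [F], because [2 * h <= #|V|]. *)
Lemma popular_family (F : {set {ffun 'I_h -> V}}) :
  (#|F| <= #|V| * #|[set f in F | [forall a, popular F a (f a)]]|)%N.
Proof.
set F' := [set f in F | _].
have FF' : (#|F'| + #|F :\: F'| = #|F|)%N.
  rewrite -(cardsID F' F); congr (_ + _)%N; apply: eq_card => f.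
  by rewrite !inE; case: (f \in F).
have : (#|V| ^ 2 * #|F :\: F'| <= h * #|V| * #|F|)%N.
  have sub : (#|F :\: F'| <= \sum_(p : 'I_h * V | ~~ popular F p.1 p.2)
      #|[set f in F | f p.1 == p.2]|)%N.
    apply: (@leq_trans #|\bigcup_(p : 'I_h * V | ~~ popular F p.1 p.2)
        [set f in F | f p.1 == p.2]|).
      apply: subset_leq_card; apply/subsetP => f; rewrite !inE => /andP[+ fF]; rewrite fF /=.
      move=> /forallPn [a na]; apply/bigcupP; exists (a, f a) => //=.
      by rewrite inE fF eqxx.
    elim/big_rec2: _ => [|p m A _ IH]; first by rewrite cards0.
    apply: leq_trans (leq_card_setU _ _) _; exact: leq_add.
  apply: leq_trans (leq_mul (leqnn _) sub) _.
  have -> : (h * #|V| * #|F| = \sum_(p : 'I_h * V) #|F|)%N.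
    by rewrite sum_nat_const card_prod card_ord.
  rewrite big_distrr /= big_mkcond /=; apply: leq_sum => p _.
  by case: ifPn => //; rewrite /popular -ltnNge => /ltnW.
rewrite -mulnn -mulnA mulnAC [X in (_ <= X)%N]mulnC leq_pmul2l // => VD.
have D2 : (2 * #|F :\: F'| <= #|F|)%N.
  rewrite -(@leq_pmul2l #|V|) // mulnCA.
  apply: leq_trans (leq_mul (leqnn 2) VD) _.
  by rewrite mulnA leq_mul.
apply: leq_trans (leq_mul V2 (leqnn _)); lia.
Qed.

(** [rich_cover] is applied twice: to the classes of images of the indices outside [Q], which cover
    all but [U]; then, for fixed [y], to the members sending [p y] to [y], whose other images have
    the correct adjacency to [y]. *)
Lemma near_blowup_structure (F : {set {ffun 'I_h -> V}}) :
  F \subset embeddings H G -> rich 3 F ->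
  (0 < N)%N -> (2 * N * #|Q|.+1 <= #|V|)%N ->
  (#|V| ^ (2 * #|Q| + 6) * (2 * N - 1) ^ h < (2 * N) ^ h)%N ->
  exists (U : {set V}) (p : V -> 'I_h),
  [/\ (#|U| * N <= #|V|)%N,
      forall y, y \notin U -> exists2 f, f \in F & f (p y) = y
    & forall y, y \notin U ->
      (#|[set z | (z \notin U) && ~~ ((p y != p z)
          && (adj G y z == adj H (p y) (p z)))]| * N <= #|V|)%N].
Proof.
move=> FE /rich_agree [F1 [F1F rF1 aF1]] N0 NV powV.
have F1E : F1 \subset embeddings H G by exact: subset_trans FE.
pose F2 := [set f in F1 | [forall a, popular F1 a (f a)]].
have F21 f : f \in F2 -> f \in F1 by rewrite inE => /andP[].
have rF2 : rich (3 + #|Q| + 1) F2.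
  by apply: rich_trans rF1 _; rewrite expn1; exact: popular_family.
pose X a := [set f a | f : {ffun 'I_h -> V} in F2].
(* The classes come from [F2], whose values are popular in [F1], but they are separated from the
   images under all of [F1]; the second covering works in [F1]. *)
have X1 (a b : 'I_h) y : a \notin Q -> b \notin Q -> y \in X a ->
    y \in [set f b | f : {ffun 'I_h -> V} in F1] -> a = b.
  move=> aQ bQ /imsetP[f fF ->] /imsetP[g gF E].
  by apply: (agree_disjoint F1E aF1 (F21 _ fF) gF).
(* The exponents needed are 2|Q| + 5 and 2|Q| + 6: 3 from richness, |Q| from agreement, 1 or 2 from
   popularity, and |Q| + 1 from the uncovered coordinates. *)
have pow' c : (c <= 2 * #|Q| + 6)%N -> (#|V| ^ c * (2 * N - 1) ^ h < (2 * N) ^ h)%N.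
  move=> cQ; apply: leq_ltn_trans powV; rewrite leq_mul //.
  exact: leq_pexp2l.
(* On [U] the value is an arbitrary default. *)
pose p y := if [pick a | (a \notin Q) && (y \in X a)] is Some a then a else Ordinal h0.
pose U := ~: (\bigcup_(a in ~: Q) X a); exists U, p.
have pP y : y \notin U -> (p y \notin Q) && (y \in X (p y)).
  rewrite inE negbK => /bigcupP[a aQ yX]; rewrite /p; case: pickP => //= /(_ a).
  by rewrite yX andbT; move: aQ; rewrite inE => ->.
split.
- apply: (@rich_cover _ _ (3 + #|Q| + 1) #|Q| N F2) => //.
  + by move=> f b fF _; exact: imset_f.
  + move=> a b; rewrite !inE => aQ bQ ab; apply/pred0P => y /=; apply/negP => /andP[ya yb].
    case/eqP: ab; apply: (X1 _ _ y) => //.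
    by case/imsetP: yb => f /F21 fF ->; exact: imset_f.
  + by rewrite cardsCs setCK card_ord; have := max_card (mem Q); rewrite card_ord; lia.
  + apply: pow'; lia.
- move=> y /pP /andP[_ /imsetP[f fF E]]; exists f => //.
  exact: (subsetP F1F) (F21 _ fF).
- move=> y yU; have /andP[pQ pX] := pP y yU.
  pose B := ~: Q :\ p y.
  pose Y b := [set f b | f : {ffun 'I_h -> V} in F1] :&: [set z | adj G y z == adj H (p y) b].
  apply: (@leq_trans (#|~: \bigcup_(b in B) Y b| * N)).
    rewrite leq_mul2r; apply/orP; right; apply: subset_leq_card; apply/subsetP => z.
    rewrite inE => /andP[zU nz]; rewrite inE; apply: contra nz => /bigcupP[b bB].
    rewrite inE [z \in [set z | _]]inE => /andP[zb az].
    have /andP[zQ zX] := pP z zU.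
    move: bB; rewrite !inE => /andP[bp bQ].
    have zpb := X1 _ _ z zQ bQ zX zb; rewrite zpb az andbT.
    by rewrite eq_sym.
  apply: (@rich_cover _ _ (3 + #|Q| + 2) #|Q| N [set f in F1 | f (p y) == y]) => //.
  + move=> f b; rewrite !inE => /andP[fF /eqP fp] _.
    have /embeddingsP[_ fG] := subsetP F1E _ fF.
    rewrite -fG fp eqxx andbT.
    exact: (imset_f (fun f : {ffun 'I_h -> V} => f b)).
  + move=> a b; rewrite !inE => /andP[_ aQ] /andP[_ bQ] ab; apply/pred0P => z /=; apply/negP.
    rewrite !inE => /andP[/andP[/imsetP[f fF ->] _] /andP[/imsetP[g gF E] _]].
    by case/eqP: ab; apply: (agree_disjoint F1E aF1 fF gF).
  + have := cardsD1 (p y) (~: Q); rewrite inE pQ -/B => E.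
    by have := cardsC Q; rewrite card_ord E; lia.
  + apply: pow'; lia.
  + apply: rich_trans rF1 _.
    case/imsetP: pX => f fF E.
    move: fF; rewrite inE => /andP[_ /forallP/(_ (p y))].
    by rewrite /popular -E.
Qed.
End structure.

(** * An embedding with few exceptional pairs *)

(** The product (h+1)...(2h) is at least h^h, and it equals C(2h, h) h!, where C(2h, h) is at most
    4^h. *)
Lemma self_exp_le_fact (h : nat) : (h ^ h <= 4 ^ h * h`!)%N.
Proof.
have : (h ^ h <= (h + h) ^_ h)%N.
  apply: (@leq_trans (\prod_(i < h) h)); first by rewrite prod_nat_const card_ord.
  by rewrite ffact_prod; apply: leq_prod => i _; have := ltn_ord i; lia.
rewrite -bin_ffact => /leq_trans; apply; rewrite leq_mul2r; apply/orP; right.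
rewrite (_ : 4 ^ h = (1 + 1) ^ (h + h))%N; last by rewrite expnD -expnMn.
rewrite Pascal (bigD1 (inord h)) //= inordK; last by rewrite ltnS leq_addr.
by rewrite !exp1n !muln1 leq_addr.
Qed.

Section bad_entries.
Variables (V : finType) (R : rel V) (U : {set V}) (k : nat).
Hypothesis Rsym : symmetric R.

Definition bad_entry (t : seq V) : pred V :=
  fun x => (x \in U) || (k <= count (R x) t)%N.

Definition related_pairs (t : seq V) : nat :=
  (\sum_(y <- t) \sum_(z <- t) R y z)%N.

Lemma sum_nat_count (T : Type) (P : pred T) (t : seq T) :
  (\sum_(y <- t) P y = count P t)%N.
Proof. by rewrite -sum1_count [RHS]big_mkcond; apply: eq_bigr => y _; case: (P y). Qed.

(** The entries of [t] have at most [h * d <= K * k * d] related vertices in total, so at most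
    [K * d] vertices are related to [k] entries; [U] contributes [d] more. *)
Lemma card_bad_entry (d K h : nat) (t : seq V) :
  (#|U| <= d)%N -> (forall y, #|[set z | R y z]| <= d)%N ->
  (0 < k)%N -> (h <= K * k)%N -> (size t <= h)%N ->
  (#|[set x | bad_entry t x]| <= d * K.+1)%N.
Proof.
move=> Ud Rd k0 hK th; rewrite -(@leq_pmul2l k) //.
have cU : (#|[set x | bad_entry t x]| <= #|U| + #|[set x | k <= count (R x) t]|)%N.
  apply: leq_trans (leq_card_setU _ _); apply: subset_leq_card.
  by apply/subsetP => x; rewrite !inE.
have cR : (k * #|[set x | k <= count (R x) t]| <= size t * d)%N.
  rewrite -sum1dep_card big_distrr /= big_mkcond /=.
  apply: (@leq_trans (\sum_x count (R x) t)).
    by apply: leq_sum => x _; case: ifP; rewrite ?muln1.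
  under eq_bigr => x _ do rewrite -sum_nat_count.
  rewrite exchange_big /= -sum1_size big_distrl /=; apply: leq_sum => y _.
  rewrite mul1n; apply: leq_trans (Rd y); rewrite -sum1dep_card [X in (_ <= X)%N]big_mkcond.
  rewrite leq_eqVlt; apply/orP; left; apply/eqP; apply: eq_bigr => x _.
  by rewrite Rsym; case: (R y x).
have := leq_mul (leqnn k) cU; nia.
Qed.

Lemma count_mem_num_bad (t : seq V) : (count (mem U) t <= num_bad bad_entry t)%N.
Proof.
elim: t => //= x t IH; rewrite leq_add // /bad_entry.
by case: (x \in U).
Qed.

(** A new head adds its diagonal pair and each relation to the tail twice: fewer than [k] relations
    if it is good, at most [h] if it is bad. *)
Lemma related_pairs_num_bad (h : nat) (t : seq V) : (size t <= h)%N ->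
  (related_pairs t <= size t * (1 + 2 * k) + 2 * h * num_bad bad_entry t)%N.
Proof.
rewrite /related_pairs; elim: t => [_|x t IH /= sth]; first by rewrite big_nil.
have {}IH := IH (ltnW sth).
rewrite big_cons big_cons.
under [X in (_ + X <= _)%N]eq_bigr => y _ do rewrite big_cons.
rewrite big_split /= sum_nat_count.
rewrite (eq_bigr (fun y => R x y : nat)) => [|y _]; last by rewrite Rsym.
rewrite sum_nat_count.
have : (count (R x) t <= k + h * bad_entry t x)%N.
  rewrite /bad_entry; have := count_size (R x) t.
  by case: (leqP k (count (R x) t)) => [_|ck]; rewrite ?orbT ?muln1; nia.
have : (R x x <= 1)%N by case: (R x x).
move: IH sth; nia.
Qed.

End bad_entries.

Lemma sum_perm_tuple (h : nat) (V : Type) (f : 'I_h -> V) (s : {perm 'I_h})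
    (F : V -> nat) :
  (\sum_(y <- [tuple f (s i) | i < h]) F y = \sum_i F (f i))%N.
Proof. by rewrite big_map big_enum /= [RHS](reindex_inj (@perm_inj _ s)). Qed.

Section typical.
Variables (h : nat) (H : sgraph 'I_h) (V : finType) (G : sgraph V).
Variable Q : {set 'I_h}.
Hypothesis dQ : distinguishing H Q.

(** A position with index in [Q] is identified by agreement and injectivity, any other by
    [agree_disjoint]. So a permuted tuple determines both the embedding and the permutation. *)
Lemma agree_perm_inj (F : {set {ffun 'I_h -> V}}) (f g : {ffun 'I_h -> V})
    (s t : {perm 'I_h}) :
  F \subset embeddings H G -> agree_on Q F -> f \in F -> g \in F ->
  (forall i, f (s i) = g (t i)) -> f = g /\ s = t.
Proof.
move=> FE aF fF gF fg.
have /embeddingsP[fi _] := subsetP FE _ fF; have /embeddingsP[gi _] := subsetP FE _ gF.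
have main i : s i = t i.
  case: (boolP (s i \in Q)) => siQ.
    by apply: gi; rewrite -fg; apply: aF.
  case: (boolP (t i \in Q)) => tiQ.
    by apply: fi; rewrite fg; apply: aF.
  exact: agree_disjoint FE aF fF gF siQ tiQ (fg i).
have st : s = t by apply/permP.
split=> //; apply/ffunP => j.
by have := fg ((s^-1)%g j); rewrite -st permKV.
Qed.

(* Precomposing with the h! permutations turns the members of F into distinct
   tuples; this factor is needed to beat #|V| ^ h / #|F|, which may be h ^ h. *)
Lemma typical_embedding (F : {set {ffun 'I_h -> V}}) (R : rel V) (U : {set V})
    (d K k : nat) :
  F \subset embeddings H G -> rich 3 F -> (0 < h)%N -> (2 * h <= #|V|)%N ->
  symmetric R ->
  (#|U| <= d)%N -> (forall y, #|[set z | R y z]| <= d)%N ->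
  (d * (K.+1 * 16 ^ K) <= #|V|)%N -> (0 < k)%N -> (h <= K * k)%N ->
  (#|V| ^ (3 + #|Q|) < 2 ^ h)%N ->
  exists2 f, f \in F & (#|[set i | f i \in U]| < k)%N
    /\ (#|[set p : 'I_h * 'I_h | R (f p.1) (f p.2)]| <= h + 4 * h * k)%N.
Proof.
move=> FE rF h0 h2V Rsym Ud Rd dV k0 hK V2h.
have hV : (0 < #|V|)%N by lia.
have [F1 [F1F rF1 aF1]] := rich_agree Q h0 h2V rF.
have F1E : F1 \subset embeddings H G by exact: subset_trans FE.
apply: contrapT => no.
pose nb (t : seq V) := num_bad (bad_entry R U k) t.
(* Fewer than [k] bad entries would make [f] a witness: at most [h * (1 + 2 * k) + 2 * h * k]
   related pairs. *)
have bad f (s : {perm 'I_h}) : f \in F1 -> (k <= nb [tuple f (s i) | i < h])%N.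
  move=> fF1; rewrite leqNgt; apply/negP => lt; apply: no.
  exists f; first exact: (subsetP F1F).
  split.
    apply: leq_ltn_trans lt; apply: leq_trans (count_mem_num_bad _ _ _ _).
    rewrite -sum_nat_count sum_perm_tuple -sum1dep_card big_mkcond.
    by apply: leq_sum => i _ /=; case: (f i \in U).
  have := @related_pairs_num_bad _ R U k Rsym h [tuple f (s i) | i < h].
  rewrite size_tuple => /(_ (leqnn h)); rewrite -/(nb _) => tot.
  apply: (@leq_trans (related_pairs R [tuple f (s i) | i < h])); last first.
    apply: leq_trans tot _; move: lt; nia.
  rewrite /related_pairs sum_perm_tuple.
  rewrite (eq_bigr (fun i => \sum_j R (f i) (f j)))%N => [|i _]; last by rewrite sum_perm_tuple.
  rewrite pair_big /= -sum1dep_card big_mkcond; apply: leq_sum => p _.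
  by case: (R _ _).
pose BT := [set t : h.-tuple V | (k <= nb t)%N].
(* The base 16 is 2 * 4 * 2: the moment bound loses [2 ^ h], replacing [h ^ h] by the factorial
   loses [4 ^ h], and the remaining [2 ^ h] beats [#|V| ^ (3 + #|Q|)]. *)
have cBT : (#|BT| * 8 ^ h <= #|V| ^ h)%N.
  have := @card_num_bad V (bad_entry R U k) h (d * K.+1) (16 ^ K) k.
  rewrite expn_gt0 /= => cb.
  have {}cb : (#|BT| * (16 ^ K) ^ k <= (2 * #|V|) ^ h)%N.
    apply: cb => //; last by rewrite mulnC -mulnA.
    move=> t th; apply: (card_bad_entry Rsym Ud Rd k0 hK); exact: ltnW.
  rewrite -(@leq_pmul2l (2 ^ h)) ?expn_gt0 // -expnMn mulnCA -expnMn.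
  apply: leq_trans cb; rewrite leq_mul2l -expnM; apply/orP; right.
  exact: leq_pexp2l.
have cF1 : (#|F1| * h`! <= #|BT|)%N.
  rewrite -card_Sn -cardsT -cardsX.
  rewrite -(@card_in_imset _ _
    (fun p : {ffun 'I_h -> V} * {perm 'I_h} => [tuple p.1 (p.2 i) | i < h])).
    apply: subset_leq_card; apply/subsetP => _ /imsetP[[f s] + ->] /=.
    by rewrite inE => /andP[fF _]; rewrite inE; exact: bad.
  move=> [f s] [g t]; rewrite !inE /= !andbT => fF gF /(congr1 (fun t => tnth t)) E.
  have [|-> ->//] := agree_perm_inj (s := s) (t := t) F1E aF1 fF gF.
  by move=> i; have /(congr1 (@^~ i)) := E; rewrite !tnth_mktuple.
have : (#|V| ^ h * (4 ^ h * h`!) * 2 ^ h <= #|V| ^ h * (4 ^ h * h`!) * #|V| ^ (3 + #|Q|))%N.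
  have := self_exp_le_fact h; move: rF1; rewrite /rich => r1 r2.
  apply: (@leq_trans (#|F1| * h`! * 8 ^ h * #|V| ^ (3 + #|Q|) * h ^ h)).
    rewrite (_ : (8 = 4 * 2)%N) // expnMn; move: r1; set a := (4 ^ h)%N; set b := (2 ^ h)%N.
    move=> r1; have := leq_mul r1 (leqnn (a * h`! * b)).
    lia.
  have := leq_mul (leq_mul (leq_trans (leq_mul cF1 (leqnn (8 ^ h))) cBT)
    (leqnn (#|V| ^ (3 + #|Q|)))) r2.
  lia.
by rewrite leq_pmul2l ?muln_gt0 ?expn_gt0 ?hV ?fact_gt0 // leqNgt V2h.
Qed.
End typical.

(** * Rigidity *)

Lemma card_changed_pairs (T I : finType) (P : rel T) (G1 G2 : sgraph T)
    (e : T -> I) (A : {set I * I}) : injective e ->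
  (forall x y, P x y -> adj G1 x y != adj G2 x y -> (e x, e y) \in A) ->
  (#|changed_pairs P G1 G2| <= #|A|)%N.
Proof.
move=> ei PA; apply: leq_trans (leq_imset_card _ _) _.
rewrite -(@card_imset _ _ (fun p : T * T => (e p.1, e p.2))); last first.
  by move=> [x y] [x' y'] /= [/ei -> /ei ->].
apply: subset_leq_card; apply/subsetP => _ /imsetP[[x y] + ->] /=.
by rewrite inE /= => /andP[]; exact: PA.
Qed.

Section rigidity.
Variables (R : realType) (h : nat) (H : sgraph 'I_h).
Hypothesis saB : sa_blowups R H.
Hypothesis saJ : sa_bijections R H.
Variables (J : {set 'I_h}) (pi : 'I_h -> 'I_h).

(** Pairs are ordered, and those inside a fibre of [pi], the diagonal included, count as broken. *)
Definition broken_pairs : {set 'I_h * 'I_h} :=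
  [set p | [&& p.1 \in J, p.2 \in J
    & ~~ ((pi p.1 != pi p.2) && (adj H p.1 p.2 == adj H (pi p.1) (pi p.2)))]].

Hypothesis J8 : 8 / 10 * h%:R <= #|J|%:R :> R.
Hypothesis few : #|broken_pairs|%:R <= h%:R ^+ 2 / 10 ^+ 5 :> R.

(** The square of a fibre consists of broken pairs, and (h/100)^2 already exceeds the allowed
    h^2/10^5. *)
Lemma card_fiber_le (s : 'I_h) :
  #|[set i in J | pi i == s]|%:R <= h%:R / 100 :> R.
Proof.
rewrite leNgt; apply/negP => big.
set A := [set i in J | _] in big.
have : (#|A| * #|A| <= #|broken_pairs|)%N.
  rewrite -cardsX; apply: subset_leq_card; apply/subsetP => -[i j].
  by rewrite !inE /= => /andP[/andP[-> /eqP ->] /andP[-> /eqP ->]]; rewrite eqxx.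
rewrite -(ler_nat R) natrM => /le_trans/(_ few).
have h0 : 0 <= h%:R :> R by [].
have -> : h%:R ^+ 2 / 10 ^+ 5 = (h%:R / 100) ^+ 2 / 10 :> R by field.
have : 0 <= h%:R / 100 :> R by rewrite divr_ge0.
move: big; set a : R := #|A|%:R; set b : R := h%:R / 100; rewrite expr2 => big b0.
move=> ab; nra.
Qed.

(** Otherwise H[J] differs in few blowup pairs from the blowup of H[pi(J)] whose parts are the
    fibres of [pi], against condition 4. The bijection [e] enumerates each fibre. *)
Lemma card_image_gt : 7 / 10 * h%:R < #|pi @: J|%:R :> R.
Proof.
rewrite ltNge; apply/negP => S7.
pose S := pi @: J; pose I := {x : 'I_h | x \in S}.
pose A (s : I) := [set i in J | pi i == val s].
pose a (s : I) := #|A s|.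
have eA (v : blowup_vertex a) : enum_val (tagged v : 'I_#|A (tag v)|) \in A (tag v).
  exact: enum_valP.
have eJ (v : blowup_vertex a) : enum_val (tagged v : 'I_#|A (tag v)|) \in J.
  by have := eA v; rewrite inE => /andP[].
pose e (v : blowup_vertex a) : {x : 'I_h | x \in J} := @exist 'I_h (fun x => x \in J) _ (eJ v).
have pie v : pi (val (e v)) = val (tag v).
  by have := eA v; rewrite inE => /andP[_ /eqP].
have ei : injective e.
  move=> u v uv; have := pie u; rewrite uv pie => /val_inj tuv.
  case: u v uv tuv => s i [s' j] /= uv ss'; subst s'.
  by move: uv => /(congr1 val) /= /enum_val_inj ->.
have piS (i : {x : 'I_h | x \in J}) : pi (val i) \in S by apply: imset_f; exact: valP.
have iA (i : {x : 'I_h | x \in J}) :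
    val i \in A (@exist 'I_h (fun x => x \in S) (pi (val i)) (piS i)).
  by rewrite inE /= eqxx andbT; exact: valP.
pose g (i : {x : 'I_h | x \in J}) : blowup_vertex a :=
  Tagged (fun s => 'I_(a s)) (enum_rank_in (iA i) (val i)).
have gK : cancel g e by move=> i; apply: val_inj; rewrite /= enum_rankK_in // iA.
have eb : bijective e.
  by apply: (Bijective _ gK) => v; apply: ei; rewrite gK.
have cJ : #|J| = #|blowup_vertex a| by rewrite (bij_eq_card eb) card_sig.
have := @saB S a J S7; rewrite -cJ; apply.
- move=> [s sS]; rewrite card_gt0; apply/set0Pn.
  have /imsetP[i iJ E] := sS; exists i.
  by rewrite inE iJ /= E.
- by move=> s; exact: card_fiber_le.
- exact: J8.
- by have := max_card (mem J); rewrite card_ord.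
- by [].
exists (pullback (induced H J) e); split.
  apply: le_trans few; rewrite ler_nat.
  apply: (@card_changed_pairs _ _ _ _ _ (fun v => val (e v))).
    by move=> u v /val_inj/ei.
  move=> u v; rewrite /blowup_pair adj_pullback !adj_mk /induced_rel.
  rewrite /blowup_rel adj_mk /induced_rel => uv.
  rewrite -!pie inE /= !(valP (e _)) /= => ne.
  by rewrite negb_and eq_sym [X in _ || ~~ X]eq_sym ne orbT.
exists e; split=> // x y; by rewrite adj_pullback.
Qed.

(** Choosing one preimage for each of exactly ceil(0.7h) image points turns [pi] into a bijection.
    Condition 5 leaves it fewer than 0.1h non-stationary points. *)
Lemma card_stationary_ge :
  6 / 10 * h%:R <= #|[set i in J | pi i == i]|%:R :> R.
Proof.
pose c := `|Num.ceil (7 / 10 * h%:R : R)|%N.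
have c0 : 0 <= 7 / 10 * h%:R :> R by rewrite mulr_ge0 // divr_ge0.
have cE : Posz c = Num.ceil (7 / 10 * h%:R : R).
  by rewrite /c gez0_abs // ceil_ge0 (lt_le_trans _ c0) // ltrN10.
have c7 : 7 / 10 * h%:R <= c%:R :> R.
  have := ceil_ge (7 / 10 * h%:R : R); by rewrite -cE.
have cS : (c <= #|pi @: J|)%N.
  rewrite -lez_nat cE ceil_le_int -pmulrn; exact/ltW/card_image_gt.
have [s [us sc sS]] := card_geqP cS.
pose K := [set x in s].
have cK : #|K| = c by rewrite -sc -(card_uniqP us); apply: eq_card => x; rewrite inE.
have ex x : exists i, x \in K -> i \in J /\ pi i = x.
  case: (boolP (x \in K)) => [|_]; last by exists x.
  by rewrite inE => /sS /imsetP[i iJ ->]; exists i.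
pose sec x := projT1 (cid (ex x)).
have secP x : x \in K -> sec x \in J /\ pi (sec x) = x.
  by move=> xK; rewrite /sec; case: cid => i /= /(_ xK).
pose J' := sec @: K.
have J'J i : i \in J' -> i \in J by case/imsetP => x /secP[xJ _] ->.
have J'K i : i \in J' -> pi i \in K.
  by case/imsetP => x xK ->; have [_ ->] := secP x xK.
have cJ' : #|J'| = c.
  rewrite card_in_imset // => x y xK yK E.
  by have [_ <-] := secP x xK; have [_ <-] := secP y yK; rewrite E.
pose f (i : {x : 'I_h | x \in J'}) : {x : 'I_h | x \in K} :=
  @exist 'I_h (fun x => x \in K) (pi (val i)) (J'K _ (valP i)).
have secJ' x : x \in K -> sec x \in J' by exact: imset_f.
pose g (x : {x : 'I_h | x \in K}) : {x : 'I_h | x \in J'} :=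
  @exist 'I_h (fun x => x \in J') (sec (val x)) (secJ' _ (valP x)).
have fb : bijective f.
  exists g => x; apply: val_inj; rewrite /=.
    have /imsetP[y yK ->] := valP x; by have [_ ->] := secP y yK.
  by have [_ ->] := secP _ (valP x).
have nonstat : #|[set v | val (f v) != val v]|%:R < h%:R / 10 :> R.
  rewrite ltNge; apply/negP => big.
  have := @saJ J' K f; rewrite cJ' cK cE => /(_ erefl erefl fb big); apply.
  exists (pullback (induced H K) f); split.
    apply: le_trans few; rewrite ler_nat.
    apply: (@card_changed_pairs _ _ _ _ _ val); first exact: val_inj.
    move=> u v _; rewrite adj_pullback !adj_mk /induced_rel /= => ne.
    by rewrite inE /= !J'J ?(valP u) ?(valP v) //= negb_and ne orbT.
  by split=> // x y; rewrite adj_pullback.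
have stat : (c - #|[set v | val (f v) != val v]| <= #|[set i in J | pi i == i]|)%N.
  rewrite -cJ' -card_sig -[X in (X - _)%N](cardsC [set v | val (f v) != val v]) addKn.
  rewrite -(card_imset _ val_inj); apply: subset_leq_card; apply/subsetP => _ /imsetP[v + ->].
  rewrite !inE negbK /= => ->; rewrite andbT.
  exact: J'J (valP v).
move: stat; rewrite leq_subLR -(ler_nat R) natrD; lra.
Qed.
End rigidity.

(** * Uniqueness of roles *)

Section unique_role.
Variables (R : realType) (h : nat) (H : sgraph 'I_h) (V : finType) (G : sgraph V).
Hypothesis saH : strongly_asymmetric R H.
Variables (Q : {set 'I_h}) (K k : nat).
Hypothesis dQ : distinguishing H Q.

(** With exponent 3, the at most [h * #|V|] pairs that are not roles account for at most h / |V|^2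
    times (|V| / h)^h embeddings. *)
Definition role (w : 'I_h) (x : V) : bool :=
  rich 3 [set f in embeddings H G | f w == x].

Lemma unique_role (w w' : 'I_h) (x : V) :
  let N := (K.+1 * 16 ^ K)%N in
  (40 < h)%N -> (5 * k <= h)%N -> (0 < k)%N -> (h <= K * k)%N ->
  (h + 4 * h * k)%:R <= h%:R ^+ 2 / 10 ^+ 5 :> R ->
  (2 * h <= #|V|)%N -> (2 * N * #|Q|.+1 <= #|V|)%N ->
  (#|V| ^ (2 * #|Q| + 6) * (2 * N - 1) ^ h < (2 * N) ^ h)%N ->
  (#|V| ^ (3 + #|Q|) < 2 ^ h)%N ->
  role w x -> role w' x -> w = w'.
Proof.
move=> N h40 kh k0 hK few hV NV powV V2h rw rw'; apply/eqP/negPn/negP => ww'.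
have [_ [sa2 _] _ saB saJ] := saH.
have h0 : (0 < h)%N by lia.
have N0 : (0 < N)%N by rewrite /N muln_gt0 expn_gt0.
have sub w0 : [set f in embeddings H G | f w0 == x] \subset embeddings H G.
  by apply/subsetP => f; rewrite inE => /andP[].
have [U [p [UN pU degN]]] := near_blowup_structure dQ h0 hV (sub w') rw' N0 NV powV.
(* [D] bounds both [#|U|] and the number of partners of a vertex under [rel]; the form of [N] is
   what [typical_embedding] demands of [D]. *)
pose D := (#|V| %/ N)%N.
pose rel y z := [&& y \notin U, z \notin U
  & ~~ ((p y != p z) && (adj G y z == adj H (p y) (p z)))].
have relS : symmetric rel.
  move=> y z; rewrite /rel andbCA; congr [&& _, _ & _].
  by rewrite eq_sym adj_sym (adj_sym H).
have [f fF [fU frel]] : exists2 f, f \in [set f in embeddings H G | f w == x] &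
    (#|[set i | f i \in U]| < k)%N
    /\ (#|[set q : 'I_h * 'I_h | rel (f q.1) (f q.2)]| <= h + 4 * h * k)%N.
  apply: (typical_embedding dQ (sub w) rw h0 hV relS (d := D) (K := K)) => //.
  - by rewrite leq_divRL.
  - move=> y; case: (boolP (y \in U)) => yU.
      rewrite (_ : [set z | _] = set0) ?cards0 //.
      by apply/setP => z; rewrite !inE /rel yU.
    rewrite leq_divRL //; apply: leq_trans (degN y yU).
    rewrite leq_mul2r; apply/orP; right; apply: subset_leq_card; apply/subsetP => z.
    by rewrite !inE /rel yU.
  - exact: leq_trunc_div.
pose J := [set i | f i \notin U].
have J8 : 8 / 10 * h%:R <= #|J|%:R :> R.
  have cJ : (#|[set i | f i \in U]| + #|J| = h)%N.
    rewrite -[RHS]card_ord -(cardsC [set i | f i \in U]); congr (_ + _)%N.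
    by apply: eq_card => i; rewrite !inE.
  have : (8 * h <= 10 * #|J|)%N by lia.
  by rewrite -(ler_nat R) !natrM; lra.
have fewJ : #|broken_pairs H J (fun i => p (f i))|%:R <= h%:R ^+ 2 / 10 ^+ 5 :> R.
  apply: le_trans few; rewrite ler_nat; apply: leq_trans frel.
  move: fF; rewrite inE => /andP[/embeddingsP[_ fG] _].
  apply: subset_leq_card; apply/subsetP => -[i j]; rewrite !inE /= /rel => /and3P[-> ->].
  by rewrite fG.
have := card_stationary_ge saB saJ J8 fewJ.
have /sa2 : #|[set w; w']| = 2 by rewrite cards2 ww'.
set St := [set i in J | _].
(* For stationary [i], some [g] sending [w'] to [x] satisfies [g i = f i], while [f w = x]. So the
   one pair [f i], [x] of [G] decides the adjacency of [i] both to [w] and to [w']. *)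
have : (#|St| <= #|agreement H [set w; w']| + 2)%N.
  have -> : 2%N = #|[set w; w']| by rewrite cards2 ww'.
  apply: leq_trans (leq_card_setU _ _); apply: subset_leq_card.
  apply/subsetP => i; rewrite inE inE => /andP[iU /eqP pi].
  case: (boolP (i \in [set w; w'])) => iw; rewrite inE ?iw ?orbT // (negbTE iw) orbF.
  rewrite inE inE iw /=.
  have [g] := pU _ iU; rewrite pi inE => /andP[/embeddingsP[_ gG] /eqP gw] gi.
  move: fF; rewrite inE => /andP[/embeddingsP[_ fG] /eqP fw].
  have E : adj H i w = adj H i w' by rewrite -fG -gG gw fw gi.
  case E1: (adj H i w).
    by apply/orP; left; apply/forall_inP => s; rewrite !inE => /orP[]/eqP -> //; rewrite -E.
  by apply/orP; right; apply/forall_inP => s; rewrite !inE => /orP[]/eqP ->; rewrite -?E E1.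
(* 0.6h <= 0.55h + 2 fails for h > 40. *)
rewrite -(ler_nat R) natrD; move: h40; rewrite -(ltr_nat R); lra.
Qed.
End unique_role.

(** * Counting embeddings and the choice of parameters *)

Lemma card_embeddings_le (h : nat) (H : sgraph 'I_h) (V : finType) (G : sgraph V) :
  (forall w w' x, role H G w x -> role H G w' x -> w = w') ->
  (#|embeddings H G| * h ^ h * #|V| ^ 2 <= #|V| ^ h * (#|V| ^ 2 + h))%N.
Proof.
move=> uniq_role.
case: (posnP #|V|) => [->|V0]; first by rewrite muln0.
pose F := [set f in embeddings H G | [forall w, role H G w (f w)]].
have EF : (#|embeddings H G| = #|F| + #|embeddings H G :\: F|)%N.
  rewrite -(cardsID F (embeddings H G)) (setIidPr _) //.
  by apply/subsetP => f; rewrite inE => /andP[].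
have cF : (#|F| * h ^ h <= #|V| ^ h)%N.
  have := @card_family_le _ _ F [set: 'I_h] (fun w => [set x | role H G w x]).
  rewrite cardsT card_ord subnn addn0 mul1n => /(_ _ _)/leq_trans; apply.
  - by move=> f w; rewrite !inE => /andP[_ /forallP/(_ w)].
  - move=> w w' _ _; apply: contra_neqT => /pred0Pn[x /=].
    by rewrite !inE => /andP[]; exact: uniq_role.
  - by apply: expn_le_compat; exact: max_card.
have cJ : (#|embeddings H G :\: F| * #|V| ^ 3 * h ^ h <= h * #|V| * #|V| ^ h)%N.
  have sub : (#|embeddings H G :\: F| <= \sum_(p : 'I_h * V | ~~ role H G p.1 p.2)
      #|[set f in embeddings H G | f p.1 == p.2]|)%N.
    apply: (@leq_trans #|\bigcup_(p : 'I_h * V | ~~ role H G p.1 p.2)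
        [set f in embeddings H G | f p.1 == p.2]|).
      apply: subset_leq_card; apply/subsetP => f; rewrite inE => /andP[+ fF].
      rewrite inE fF /= => /forallPn [w nw]; apply/bigcupP; exists (w, f w) => //=.
      by rewrite inE fF eqxx.
    elim/big_rec2: _ => [|p m A _ IH]; first by rewrite cards0.
    apply: leq_trans (leq_card_setU _ _) _; exact: leq_add.
  rewrite -mulnA; apply: leq_trans (leq_mul sub (leqnn _)) _.
  have -> : (h * #|V| * #|V| ^ h = \sum_(p : 'I_h * V) #|V| ^ h)%N.
    by rewrite sum_nat_const card_prod card_ord.
  rewrite big_distrl /= big_mkcond /=; apply: leq_sum => p _.
  by case: ifPn => //; rewrite /role /rich -ltnNge mulnA => /ltnW.
have {}cJ : (#|embeddings H G :\: F| * #|V| ^ 2 * h ^ h <= h * #|V| ^ h)%N.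
  rewrite -(leq_pmul2l V0); apply: leq_trans (leq_trans cJ _); last by rewrite mulnCA mulnA.
  by rewrite (expnS _ 2); lia.
rewrite EF; move: cF cJ; move: (#|F|) (#|_ :\: _|) (#|V| ^ 2)%N (h ^ h)%N (#|V| ^ h)%N => a b c d e.
by move=> H1 H2; have := leq_mul H1 (leqnn c); nia.
Qed.

Lemma max_induced_le_embeddings (U : finType) (H : sgraph U) (n a b : nat) :
  (forall G : sgraph 'I_n, #|embeddings H G| * a <= b)%N ->
  (max_induced H n * a <= b)%N.
Proof.
move=> Hab; rewrite /max_induced.
elim/big_ind: _ => // [x y xa ya|G _]; first by case: (leqP x y).
by apply: leq_trans (Hab G); rewrite leq_mul // num_induced_le_embeddings.
Qed.

(** Induction over the factors: passing from [n] to [n - j] with [j < h] costs at most [h] in the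
    linear term. *)
Lemma ffact_ge (n h : nat) : (h * h <= n)%N -> (n ^ h * (n - h * h) <= n ^_ h * n)%N.
Proof.
move=> hn.
suff: forall j, (j <= h)%N -> (n ^ j * (n - j * h) <= n ^_ j * n)%N by apply.
elim=> [|j IH jh]; first by rewrite ffactn0 mul0n subn0.
rewrite ffactnSr -mulnA [((n - j) * n)%N]mulnC mulnA.
have {}IH := IH (ltnW jh).
apply: leq_trans (leq_mul IH (leqnn (n - j))).
rewrite expnSr -!mulnA leq_mul2l; apply/orP; right.
have : (j * h + h <= n)%N by apply: leq_trans hn; rewrite -mulSnr leq_mul.
rewrite mulSnr; move: jh; set m := (j * h)%N; nia.
Qed.

Lemma poly_le_exp2 (c : nat) :
  exists L0, forall L, (L0 <= L)%N -> (c * L.+1 ^ 4 <= 2 ^ L)%N.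
Proof.
exists (5 * (c * 5 ^ 4))%N => L LL.
(* 2^L >= (2^t)^5 >= (t+1)^5: four factors dominate (L+1)^4 up to 5^4, the fifth absorbs the
   constants. *)
pose t := (L %/ 5)%N.
have tL : (c * 5 ^ 4 <= t)%N by rewrite leq_divRL // mulnC.
have Lt : (L.+1 <= 5 * t.+1)%N by have := divn_eq L 5; have := @ltn_pmod L 5 isT; rewrite -/t; lia.
apply: (@leq_trans (2 ^ (t * 5))); last by rewrite leq_pexp2l // leq_trunc_div.
rewrite expnM; apply: (@leq_trans (t.+1 ^ 5)); last by rewrite leq_exp2r // ltn_expl.
apply: (@leq_trans (c * (5 * t.+1) ^ 4)); first by rewrite leq_mul2l leq_exp2r // Lt orbT.
by rewrite expnMn mulnA [X in (_ <= X)%N]expnS leq_mul // ltnW // ltnS.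
Qed.

(** With r about sqrt h, and L and q of order log h, the product is O(sqrt h * log^2 h), hence
    o(h). *)
Lemma exponent_choice (M : nat) :
  exists h0 : nat, forall h q : nat, (h0 < h)%N -> (2 ^ q <= h ^ 3)%N ->
    exists r L, [/\ (h <= r ^ 3)%N, (h <= 2 ^ L)%N
      & (M * (L * r.+2 * (2 * q + 6)).+1 <= h)%N].
Proof.
have [L0 L0P] := poly_le_exp2 ((41 * M) ^ 2).
exists (2 ^ L0.+1)%N => h q hL qh.
have h1 : (1 < h)%N by apply: leq_ltn_trans hL; rewrite expn_gt0.
have [s [s0 sh hs]] : exists s, [/\ (0 < s)%N, (s ^ 2 < h)%N & (h <= s.+1 ^ 2)%N].
  have ex : exists s, (h <= s.+1 ^ 2)%N by exists h; rewrite -mulnn; nia.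
  case: (ex_minnP ex) => -[|s] hs smin; first by move: h1; rewrite ltnNge; case/negP.
  by exists s.+1; split=> //; rewrite ltnNge; apply/negP => /smin; rewrite ltnn.
pose L := trunc_log 2 h.
have [L1 L2] : (2 ^ L <= h)%N /\ (h < 2 ^ L.+1)%N.
  by split; [apply: trunc_logP => //; lia|exact: trunc_log_ltn].
have LL0 : (L0 <= L)%N.
  have := ltn_trans hL L2; rewrite ltn_exp2l // ltnS => /ltnW //.
have qL : (q <= 3 * L + 2)%N.
  have : (2 ^ q < 2 ^ (L.+1 * 3))%N by rewrite (leq_ltn_trans qh) // expnM ltn_exp2r.
  by rewrite ltn_exp2l //; lia.
exists s.+1, L.+1; split.
- by apply: leq_trans hs _; exact: leq_pexp2l.
- exact: ltnW.
have X2 : ((41 * M * L.+1 ^ 2) ^ 2 <= h)%N.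
  by apply: leq_trans L1; rewrite expnMn -expnM; exact: L0P.
(* The factors 4 and 10 below give 40; one more absorbs the successor. *)
have le1 : ((L.+1 * s.+3 * (2 * q + 6)).+1 <= 41 * L.+1 ^ 2 * s)%N.
  have q10 : (2 * q + 6 <= 10 * L.+1)%N by lia.
  have s4 : (s.+3 <= 4 * s)%N by lia.
  have := leq_mul (leq_mul (leqnn L.+1) s4) q10.
  have : (0 < L.+1 ^ 2 * s)%N by rewrite muln_gt0 expn_gt0.
  by rewrite -!mulnn; nia.
apply: leq_trans (leq_mul (leqnn M) le1) _.
have -> : (M * (41 * L.+1 ^ 2 * s) = 41 * M * L.+1 ^ 2 * s)%N by lia.
move: X2 sh; rewrite -!(mulnn (_ * _)) -(mulnn s); set X := (41 * M * _)%N => X2 sh.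
rewrite leqNgt; apply/negP => lt.
have := leq_mul X2 (ltnW sh); have := ltn_mul lt lt; nia.
Qed.

(** By Bernoulli, every [2 * N] factors of the ratio 2N / (2N - 1) gain at least 2, and [e.+1] such
    blocks fit into [h]. *)
Lemma bernoulli_decay (N h e n : nat) : (0 < N)%N -> (n <= 2 ^ e)%N ->
  (2 * N * e.+1 <= h)%N -> (n * (2 * N - 1) ^ h < (2 * N) ^ h)%N.
Proof.
move=> N0 ne hN.
have base : (2 * (2 * N - 1) ^ (2 * N) <= (2 * N) ^ (2 * N))%N.
  have [m ->] : exists m, (2 * N = m.+1)%N by exists (2 * N - 1)%N; lia.
  rewrite subn1 /= -[X in (_ <= X ^ _)%N]addn1 expnDn !big_ord_recl /=.
  rewrite !exp1n bin0 bin1 subn0 /bump /= !muln1 mul1n addnA.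
  apply: leq_trans (leq_addr _ _); rewrite mul2n -addnn leq_add //.
  by rewrite addn0 subn1 /= expnS leq_mul.
have -> : (h = 2 * N * e.+1 + (h - 2 * N * e.+1))%N by rewrite subnKC.
rewrite !expnD mulnA; set d := (h - _)%N.
apply: (@leq_trans (2 ^ e.+1 * (2 * N - 1) ^ (2 * N * e.+1) * (2 * N - 1) ^ d)); last first.
  rewrite leq_mul //; last by apply: expn_le_compat; exact: leq_subr.
  by rewrite !(expnM _ (2 * N)) -expnMn expn_le_compat.
have p0 m : (0 < (2 * N - 1) ^ m)%N by rewrite expn_gt0 subn_gt0; lia.
rewrite -!mulnA ltn_pmul2r ?muln_gt0 ?p0 //.
by apply: leq_ltn_trans ne _; rewrite ltn_exp2l.
Qed.

Lemma inducibility_le_ratio (R : realType) (h n : nat) (H : sgraph 'I_h) (e : R) :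
  (1 < h)%N -> (h ^ 2 <= n)%N -> h%:R ^+ 2 <= n%:R * e -> e <= 1 / 2 ->
  (forall (G : sgraph 'I_n) w w' x, role H G w x -> role H G w' x -> w = w') ->
  inducibility R H <= h`!%:R / (h%:R ^+ h - h%:R) * (1 + 4 * e).
Proof.
move=> h1 hn hne e12 uniq_role.
have h0 : (0 < h)%N by lia.
have n0 : (0 < n)%N by apply: leq_trans hn; rewrite expn_gt0 h0.
have hhn : (h <= n)%N by apply: leq_trans hn; rewrite -{1}(expn1 h) leq_pexp2l.
have := @inducibility_le R _ H n; rewrite card_ord => /(_ hhn) /le_trans; apply.
set M : R := (max_induced H n)%:R.
have MB : M * (h%:R ^+ h * n%:R ^+ 2) <= n%:R ^+ h * (n%:R ^+ 2 + h%:R).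
  rewrite -!natrX -natrM -natrD -!natrM ler_nat.
  apply: max_induced_le_embeddings => G; rewrite mulnA.
  have := @card_embeddings_le h H _ G; rewrite card_ord; apply; exact: uniq_role.
have CB : n%:R ^+ h * (n%:R - h%:R ^+ 2) <= 'C(n, h)%:R * h`!%:R * n%:R :> R.
  rewrite -natrM bin_ffact -!natrX -natrB // -!natrM ler_nat -mulnn.
  by apply: ffact_ge; rewrite mulnn.
have Cp : 0 < 'C(n, h)%:R :> R by rewrite ltr0n bin_gt0.
have fp : 0 < h`!%:R :> R by rewrite ltr0n fact_gt0.
have np : 0 < n%:R :> R by rewrite ltr0n.
have hp : 1 < h%:R :> R by rewrite ltr1n.
have hhp : 0 < h%:R ^+ h - h%:R :> R by rewrite subr_gt0 -{1}(expr1 h%:R) ltr_eXn2l.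
have nhp : 0 < n%:R ^+ h :> R by rewrite exprn_gt0.
rewrite ler_pdivrMr //.
have e0 : 0 <= e.
  by rewrite -(pmulr_rge0 _ np); apply: le_trans hne; rewrite exprn_ge0.
have M0 : 0 <= M by [].
have nh : n%:R ^+ h * (1 - e) <= 'C(n, h)%:R * h`!%:R :> R.
  rewrite -(ler_pM2r np); apply: le_trans CB; rewrite -mulrA ler_pM2l //; lra.
have MB' : M * h%:R ^+ h <= n%:R ^+ h * (1 + e).
  have n2p : 0 < n%:R ^+ 2 :> R by rewrite exprn_gt0.
  rewrite -(ler_pM2r n2p) -mulrA; apply: le_trans MB _; rewrite -mulrA ler_pM2l //.
  have n1 : 1 <= n%:R :> R by rewrite ler1n.
  have : h%:R <= h%:R ^+ 2 :> R by rewrite expr2; nra.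
  by move: hne; rewrite !expr2; nra.
have -> : h`!%:R / (h%:R ^+ h - h%:R) * (1 + 4 * e) * 'C(n, h)%:R
    = 'C(n, h)%:R * h`!%:R * (1 + 4 * e) / (h%:R ^+ h - h%:R) by field; rewrite gt_eqF.
rewrite ler_pdivlMr //.
apply: (@le_trans _ _ (M * h%:R ^+ h)); first by rewrite ler_wpM2l //; lra.
apply: (le_trans MB').
(* 1 + e <= (1 - e)(1 + 4e) holds for 0 <= e <= 1/2. *)
apply: (@le_trans _ _ (n%:R ^+ h * (1 - e) * (1 + 4 * e))).
  by rewrite -mulrA ler_pM2l //; nra.
by rewrite ler_wpM2r //; lra.
Qed.

Lemma powR_cuberoot_le (R : realType) (h r : nat) : (0 < h)%N -> (h <= r ^ 3)%N ->
  h%:R `^ (h%:R `^ (1 / 3)) <= h%:R ^+ r :> R.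
Proof.
move=> h0 hr; rewrite -powR_mulrn //; apply: ler_powR; first by rewrite ler1n.
have -> : r%:R = (r%:R ^+ 3) `^ (1 / 3) :> R.
  rewrite -powR_mulrn // -powRrM (_ : 3%:R * (1 / 3) = 1 :> R); last by field.
  by rewrite powRr1.
apply: ge0_ler_powR; rewrite ?nnegrE ?exprn_ge0 ?divr_ge0 //.
by rewrite -natrX ler_nat.
Qed.

Lemma powR_cuberoot_ge (R : realType) (h : nat) : (0 < h)%N ->
  h%:R <= h%:R `^ (h%:R `^ (1 / 3)) :> R.
Proof.
move=> h0; have h1 : 1 <= h%:R :> R by rewrite ler1n.
rewrite -[X in X <= _]powRr1 //; apply: ler_powR => //.
by rewrite -[X in X <= _](powRr0 h%:R); apply: ler_powR => //; rewrite divr_ge0.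
Qed.

Lemma exp2_le_of_log2 (R : realType) (h q c : nat) : (0 < h)%N ->
  q%:R <= c%:R * log2 h%:R :> R -> (2 ^ q <= h ^ c)%N.
Proof.
move=> h0; have l2 : 0 < ln 2 :> R by apply: ln_gt0; rewrite ltr1n.
rewrite /log2 mulrA ler_pdivlMr // => qh.
rewrite -(ler_nat R) !natrX -ler_ln ?posrE ?exprn_gt0 ?ltr0n //.
by rewrite !lnXn ?ltr0n // -[X in X <= _]mulr_natl -[X in _ <= X]mulr_natl.
Qed.

Theorem theorem3 (R : realType) :
  exists h0 : nat, forall (h : nat) (H : sgraph 'I_h),
    (h0 < h)%N ->
    strongly_asymmetric R H ->
    inducibility R H <=
      (h`!)%:R / (h%:R ^+ h - h%:R)
      * (1 + 4 / (h%:R `^ (h%:R `^ (1 / 3)))).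
Proof.
(* [K] is the inverse density of bad entries: with k about h/K, the bound h + 4hk has to stay below
   h^2/10^5. *)
have [K [K6 K40]] : exists K : nat, 10 ^+ 6 <= K%:R :> R /\ (40 <= K)%N.
  exists (10 ^ 6)%N; rewrite natrX lexx; split=> //.
pose N := (K.+1 * 16 ^ K)%N.
have N0 : (0 < N)%N by rewrite muln_gt0 expn_gt0.
have [h1 h1P] := exponent_choice (2 * N).
exists (maxn h1 K) => h H; rewrite gtn_max => /andP[h1h Kh] saH.
have h0 : (0 < h)%N by lia.
have [_ _ [Q [dQ qlog]] _ _] := saH.
have [r [L [hr hL hN]]] := h1P h #|Q| h1h (exp2_le_of_log2 h0 qlog).
pose e := (L * r.+2 * (2 * #|Q| + 6))%N; rewrite -/e in hN.
have L0 : (0 < L)%N by case: L hL {e hN} => //; lia.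
have eQ : (2 * #|Q| + 6 <= e)%N by rewrite leq_pmull // muln_gt0 L0.
have eh : (e < h)%N by apply: leq_trans hN; rewrite leq_pmull // muln_gt0.
(* Then h^2 / n = h^(-r), which is at most the target error because h <= r^3, while
   [n ^ (2 * #|Q| + 6)] stays below [2 ^ e]. *)
pose n := (h ^ r.+2)%N.
have hn : (h ^ 2 <= n)%N by rewrite leq_pexp2l.
have n2 : (n ^ (2 * #|Q| + 6) <= 2 ^ e)%N.
  by rewrite /e expnM expn_le_compat // expnM expn_le_compat.
have hhn : (h <= n)%N by apply: leq_trans hn; rewrite -mulnn leq_pmull.
pose Lr : R := h%:R `^ (h%:R `^ (1 / 3)).
have hLr : h%:R <= Lr by exact: powR_cuberoot_ge.
have hR : 40 < h%:R :> R by rewrite (ltr_nat R 40); lia.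
have Lr0 : 0 < Lr by lra.
apply: (@inducibility_le_ratio R h n H (Lr^-1)).
- lia.
- exact: hn.
- rewrite ler_pdivlMr // /n natrX -(addn2 r) exprD mulrC ler_wpM2r ?exprn_ge0 //.
  exact: powR_cuberoot_le.
- by rewrite div1r lef_pV2 ?posrE //; lra.
pose k := (h %/ K).+1.
have hKk : (h <= K * k)%N by rewrite ltnW // mulnC ltn_ceil; lia.
have kh : (K * (h %/ K) <= h)%N by rewrite mulnC leq_trunc_div.
move=> G w w' x.
apply: (@unique_role R h H _ G saH Q K k dQ) => //.
- lia.
- rewrite /k; move: kh; move: (h %/ K)%N => t; nia.
- have : K%:R * (h %/ K)%:R <= h%:R :> R by rewrite -natrM ler_nat.
  have : K%:R <= h%:R :> R by rewrite ler_nat ltnW.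
  rewrite natrD !natrM /k -natr1.
  have : 0 <= (h %/ K)%:R :> R by [].
  move: K6 hR; set t : R := (h %/ K)%:R; set a : R := h%:R; set b : R := K%:R.
  move=> b6 a40 t0 ba bt.
  have ta : t <= a / 10 ^+ 6.
    rewrite ler_pdivlMr ?exprn_gt0 //; apply: le_trans bt.
    by rewrite mulrC ler_wpM2r.
  have a6 : 1 <= a / 10 ^+ 6 by rewrite ler_pdivlMr ?exprn_gt0 // mul1r (le_trans b6).
  (* With u = a / 10^6 >= 1 and k <= u + 1, the left side is at most 5a + 4au <= 9au. *)
  have -> : a ^+ 2 / 10 ^+ 5 = 10 * a * (a / 10 ^+ 6) by field.
  move: ta a6; set u := a / _ => ta a6; nra.
- rewrite card_ord; apply: leq_trans hn; rewrite -mulnn leq_mul //; lia.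
- rewrite card_ord; apply: leq_trans hhn; apply: leq_trans hN.
  by rewrite leq_mul //; lia.
- by rewrite card_ord; apply: bernoulli_decay n2 hN.
- rewrite card_ord; apply: (@leq_ltn_trans (2 ^ e)); last by rewrite ltn_exp2l.
  apply: leq_trans n2; rewrite leq_pexp2l ?expn_gt0 ?h0 //; lia.
Qed.
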